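(* Let $\psi$ be a real-valued function of the positive integer $t$ with $\psi(t)\to+\infty$ as $t\to\infty$. For every continuous $1$-periodic function $f:\mathbb{R}\to\mathbb{R}$ with zero mean value $\int_0^1 f(x)\,dx=0$ there exists $\alpha\in\mathbb{R}\setminus\mathbb{Q}$ such that $$\liminf_{t\to\infty}\frac{|S_f^t(\alpha)|}{\psi(t)}=0 .$$
   Context: For a positive integer $t$, $S_f^t(\alpha)=\sum_{k=0}^{t-1} f(k\alpha)$. The $\liminf$ is over positive integers $t\to\infty$. *)

(* Defs.v *)
From mathcomp Require Import all_boot all_order all_algebra.
From mathcomp Require Import all_classical all_reals all_analysis.
Import Order.TTheory GRing.Theory Num.Theory.
Import numFieldNormedType.Exports.

Set Implicit Arguments.
Unset Strict Implicit.
Unset Printing Implicit Defensive.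

Local Open Scope ring_scope.

Definition birkhoff_sum (R : realType) (f : R -> R) (t : nat) (alpha : R) : R :=
  \sum_(k < t) f (k%:R * alpha).

(* Main.v *)
Require Import Defs.
From mathcomp Require Import all_boot all_order all_algebra.
From mathcomp Require Import all_classical all_reals all_analysis.
From mathcomp Require Import borel_hierarchy ring lra.
Import Order.TTheory GRing.Theory Num.Theory.
Import numFieldNormedType.Exports.

Local Open Scope classical_set_scope.
Local Open Scope ring_scope.

(** Write S_t for the Birkhoff sum [birkhoff_sum f t], as a function of the
rotation angle.  The key fact is that every interval of positive angles
contains, for every t, a point where |S_t| is at most a constant B that depends
on f and on the interval but not on t ([birkhoff_sum_bounded_somewhere]).

Since f has mean zero, it is, on the half-line x >= 0, the second derivative of
a bounded function H: a primitive G of f is periodic, and subtracting from G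
its own mean makes a primitive H of the difference periodic as well
([zero_mean_second_antiderivative]).  Then
Phi_t(x) = sum_(1 <= k < t) H(k x) / k^2
satisfies Phi_t'' = S_t - f(0), while |Phi_t| <= 2 sup |H| uniformly in t,
because the sum of the 1/k^2 is at most 2.  A second difference of Phi_t with
step h equals h^2 Phi_t''(c) at some point c of the interval
([second_difference_mean_value]), so that |S_t(c)| <= |f(0)| + 8 sup |H| / h^2.

Because psi tends to infinity, this makes the open set of those x for which
|S_t(x)| < psi(t) / (n + 1) for some t >= n dense among the positive angles,
for each n.  By the Baire category theorem some positive irrational angle
belongs to all of these sets, and along the corresponding times t the quotient
|S_t| / psi(t) tends to 0. *)

(** * Derivatives and primitives on a half-line *)

Lemma is_derive_continuous (R : realType) (F : R -> R) (x d : R) :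
  is_derive x 1 F d -> {for x, continuous F}.
Proof. by move=> [dF _]; apply/differentiable_continuous/derivable1_diffP. Qed.

Lemma is_derive_shift (R : realType) (F : R -> R) (x h d : R) :
  is_derive (x + h) 1 F d -> is_derive x 1 (fun y => F (y + h)) d.
Proof.
move=> dF; have dh : is_derive x 1 ((id : R -> R) + cst h) (1 + 0).
  exact: is_deriveD.
have : is_derive x 1 (F \o ((id : R -> R) + cst h)) (d * (1 + 0)).
  exact: is_derive1_comp.
by rewrite addr0 mulr1.
Qed.

Lemma is_derive_dilation (R : realType) (F : R -> R) (x k d : R) :
  is_derive (k * x) 1 F d -> is_derive x 1 (fun y => F (k * y)) (d * k).
Proof.
move=> dF; have dk : is_derive x 1 (k \*: (id : R -> R)) (k *: 1).
  exact: is_deriveZ.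
have : is_derive x 1 (F \o (k \*: (id : R -> R))) (d * (k *: 1)).
  exact: is_derive1_comp.
by rewrite /GRing.scale/= mulr1.
Qed.

Lemma MVT_is_derive (R : realType) (F dF : R -> R) (a b : R) : a < b ->
  (forall x, a <= x <= b -> is_derive x 1 F (dF x)) ->
  exists2 c, a < c < b & F b - F a = dF c * (b - a).
Proof.
move=> ab dFP.
have [x||c] := @MVT R F dF a b ab.
- by rewrite in_itv/= => /andP[ax xb]; apply: dFP; rewrite !ltW.
- by apply: derivable_within_continuous => x; rewrite in_itv/= => /dFP[].
- by rewrite in_itv/= => cab FE; exists c.
Qed.

(** The primitive is the integral from a, so its derivative is only controlled
strictly to the right of a. *)
Lemma antiderivative_half_line (R : realType) (g : R -> R) (a : R) :
  (forall x, a <= x -> {for x, continuous g}) ->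
  exists G : R -> R, forall x, a < x -> is_derive x 1 G (g x).
Proof.
move=> cg.
exists (fun x => \int[lebesgue_measure]_(t in `[a, x]) g t) => x ax.
have [||||dG gE] := @continuous_FTC1_closed R g a x (x + 1) _ _ _ _.
- by rewrite ltrDl.
- apply: continuous_compact_integrable; first exact: segment_compact.
  apply: continuous_in_subspaceT => z; rewrite inE/= in_itv/= => /andP[az _].
  exact: cg.
- by [].
- exact/cg/ltW.
- by apply: DeriveDef => //; rewrite -derive1E.
Qed.

(** A periodic function has a periodic primitive once a constant is subtracted;
the constant c is its mean value.  Passing from a to b > a makes the conclusion
hold at the endpoint b, so that the lemma can be applied again to G on the
half-line starting at b. *)
Lemma periodic_antiderivative (R : realType) (g : R -> R) (a b : R) : a < b ->
  (forall x, a <= x -> {for x, continuous g}) ->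
  (forall x, a <= x -> g (x + 1) = g x) ->
  exists G : R -> R, exists c : R,
    (forall x, b <= x -> is_derive x 1 G (g x - c)) /\
    (forall x, b <= x -> G (x + 1) = G x).
Proof.
move=> ab cg pg.
have [F dF] := @antiderivative_half_line _ _ _ cg.
have dF' x : b <= x -> is_derive x 1 F (g x) by move=> /(lt_le_trans ab)/dF.
pose c := F (b + 1) - F b.
have dG x : b <= x -> is_derive x 1 (fun y => F y - c * y) (g x - c).
  move=> bx; have dFx := dF' x bx.
  have : is_derive x 1 (F - (c \*: (id : R -> R))) (g x - c *: 1) by exact: is_deriveB.
  by rewrite /GRing.scale/= mulr1.
(* F (x + 1) - F x is constant, having derivative g (x + 1) - g x = 0, and its
   value at b is c. *)
exists (fun x => F x - c * x), c; split => // x.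
rewrite le_eqVlt => /predU1P[<-|bx]; first by rewrite /c; ring.
have dD y : b <= y <= x ->
    is_derive y 1 (fun z => F (z + 1) - F z) (g (y + 1) - g y).
  move=> /andP[yb _]; apply: is_deriveB; last exact: dF'.
  by apply/is_derive_shift/dF'; rewrite (le_trans yb)// lerDl.
have [d /andP[bd _]] := @MVT_is_derive _ _ _ _ _ bx dD.
rewrite pg ?(ltW (lt_trans ab bd))// subrr mul0r => E.
have -> : F (x + 1) = F x + c by rewrite /c; lra.
ring.
Qed.

Lemma bounded_periodic (R : realType) (H : R -> R) :
  (forall x, 0 <= x -> {for x, continuous H}) ->
  (forall x, 0 <= x -> H (x + 1) = H x) ->
  exists M : R, forall x, 0 <= x -> `|H x| <= M.
Proof.
move=> cH pH.
have cA : {within `[0, 1], continuous (fun x => `|H x|)}.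
  apply: continuous_in_subspaceT => z; rewrite inE/= in_itv/= => /andP[z0 _].
  by apply: continuous_comp; [exact: cH|exact: norm_continuous].
have [m _ mP] := @EVT_max R _ 0 1 ler01 cA.
exists `|H m| => x x0.
have pHn n y : 0 <= y -> H (y + n%:R) = H y.
  elim: n => [|n IH] y0; first by rewrite addr0.
  by rewrite -natr1 addrA pH ?IH// addr_ge0.
have [n /andP[nx xn]] : exists n : nat, n%:R <= x < n%:R + 1.
  by exists (Num.truncn x); rewrite natr1; exact: Num.Theory.truncn_itv.
rewrite -(subrK n%:R x) pHn ?subr_ge0//; apply: mP.
by rewrite in_itv/= subr_ge0 nx/= lerBlDl ltW.
Qed.

(** * The second antiderivative of a periodic function of mean zero *)

(** The function f is the second derivative of a bounded function H on the
half-line x >= 0; G is the derivative of H. *)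
Lemma zero_mean_second_antiderivative (R : realType) (f : R -> R) :
  continuous f -> periodic f 1 ->
  \int[lebesgue_measure]_(x in `[0, 1]) f x = 0 ->
  exists H G : R -> R, exists M : R,
    [/\ forall x : R, 0 <= x -> is_derive x 1 H (G x),
        forall x : R, 0 <= x -> is_derive x 1 G (f x) &
        forall x : R, 0 <= x -> `|H x| <= M].
Proof.
move=> cf pf f0.
(* The half-lines start at -2, then -1, then 0, since each integration loses a
   neighbourhood of the starting point. *)
have [|||G [c [dG pG]]] := @periodic_antiderivative R f (- 2) (- 1).
- lra.
- by move=> x _; exact: cf.
- by move=> x _; exact: pf.
have dF (x : R) : -1 <= x -> is_derive x 1 (fun y => G y + c * y) (f x).
  move=> x1; have := dG x x1 => dGx.
  have : is_derive x 1 (G + (c \*: (id : R -> R))) (f x - c + c *: 1).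
    exact: is_deriveD.
  by rewrite /GRing.scale/= mulr1 subrK.
have cF (x : R) : -1 <= x -> {for x, continuous (fun y => G y + c * y)}.
  by move=> /dF; exact: is_derive_continuous.
(* By periodicity of G, the integral of f over [0, 1] equals c. *)
have c0 : c = 0.
  move: f0; rewrite /Rintegral.
  rewrite (@continuous_FTC2 R f (fun y => G y + c * y) 0 1 ltr01).
  - by rewrite /= -[X in G X](add0r 1) pG; lra.
  - by apply: continuous_subspaceT => x; exact: cf.
  - split.
    + move=> x; rewrite in_itv/= => /andP[x0 _].
      by have [|//] := dF x; rewrite (le_trans _ (ltW x0))// oppr_le0.
    + by apply: cvg_at_right_filter; apply: cF; lra.
    + by apply: cvg_at_left_filter; apply: cF; lra.
  - move=> x; rewrite in_itv/= => /andP[x0 _]; rewrite derive1E.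
    by have [|//] := dF x; rewrite (le_trans _ (ltW x0))// oppr_le0.
have [|||H [d [dH pH]]] := @periodic_antiderivative R G (- 1) 0.
- lra.
- by move=> x /dG; exact: is_derive_continuous.
- exact: pG.
have [||M HM] := @bounded_periodic R H.
- by move=> x /dH; exact: is_derive_continuous.
- exact: pH.
exists H, (fun x => G x - d), M; split => // x x0.
have dGx : is_derive x 1 G (f x - c) by apply: dG; lra.
rewrite -[f x]subr0 -[X in f x - X]c0 -[f x - c]subr0.
exact: (@is_deriveB _ _ _ G (cst d)).
Qed.

(** * Birkhoff sums as functions of the angle *)

(** By comparison with the telescoping sum of the 1 / (k (k + 1)), k >= 1. *)
Lemma sum_inv_sqr_le2 (R : realType) (n : nat) :
  \sum_(k < n) (k.+1%:R ^- 2 : R) <= 2.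
Proof.
suff : \sum_(k < n) (k.+1%:R ^- 2 : R) <= 2 - n%:R^-1.
  by move/le_trans; apply; rewrite gerBl invr_ge0.
(* With the convention 0^-1 = 0, the bound 2 - 1 / n is also true for n = 0, but
   the telescoping step needs n >= 1. *)
elim: n => [|[|n] IH]; first by rewrite big_ord0 invr0 subr0.
  by rewrite big_ord_recr big_ord0/= expr1n invr1; lra.
rewrite big_ord_recr/=; apply: (le_trans (lerD IH (lexx _))).
have n0 : 0 < n.+1%:R :> R by rewrite ltr0n.
have -> : n.+2%:R = n.+1%:R + 1 :> R by rewrite natr1.
move: (n.+1%:R : R) n0 => x x0.
rewrite -subr_ge0 [X in 0 <= X](_ : _ = (x * (x + 1) ^+ 2)^-1); last first.
  by field; rewrite !gt_eqF// ltr_wpDl// ltW.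
by rewrite invr_ge0 mulr_ge0 ?ltW// exprn_gt0// ltr_wpDl// ltW.
Qed.

(** The mean value theorem applied to x |-> F (x + h) - F x, then to dF. *)
Lemma second_difference_mean_value (R : realType) (F dF ddF : R -> R) (a h : R) :
  0 < h ->
  (forall x, a <= x -> is_derive x 1 F (dF x)) ->
  (forall x, a <= x -> is_derive x 1 dF (ddF x)) ->
  exists2 c, a < c < a + 2 * h &
    F (a + 2 * h) - 2 * F (a + h) + F a = ddF c * h ^+ 2.
Proof.
move=> h0 d1 d2.
have dD y : a <= y <= a + h ->
    is_derive y 1 (fun z => F (z + h) - F z) (dF (y + h) - dF y).
  move=> /andP[ya _]; apply: is_deriveB; last exact: d1.
  by apply/is_derive_shift/d1; rewrite (le_trans ya)// lerDl ltW.
have [|d /andP[ad dh] E1] := @MVT_is_derive _ _ _ a (a + h) _ dD.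
  by rewrite ltrDl.
have [||c /andP[dc cdh] E2] := @MVT_is_derive _ dF ddF d (d + h).
- by rewrite ltrDl.
- by move=> x /andP[dx _]; apply: d2; rewrite ltW// (lt_le_trans ad).
exists c; first by apply/andP; split; lra.
have -> : a + 2 * h = a + h + h by ring.
have {}E2 : dF (d + h) - dF d = ddF c * h by rewrite E2; congr (_ * _); ring.
have {}E1 : F (a + h + h) - F (a + h) - (F (a + h) - F a) = ddF c * h * h.
  by rewrite E1 E2; congr (_ * _); ring.
by rewrite expr2 mulrA -E1; ring.
Qed.

Lemma birkhoff_sum_continuous (R : realType) (f : R -> R) (t : nat) :
  continuous f -> continuous (birkhoff_sum f t).
Proof.
move=> cf x; apply: cvg_big => [|k _]; first exact: add_continuous.
by apply: continuous_comp; [exact: mulrl_continuous|exact: cf].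
Qed.

(** In every interval of nonnegative angles, each Birkhoff sum takes a value
bounded independently of the number t of terms. *)
Lemma birkhoff_sum_bounded_somewhere (R : realType) (f : R -> R) (a h : R) :
  continuous f -> periodic f 1 ->
  \int[lebesgue_measure]_(x in `[0, 1]) f x = 0 -> 0 <= a -> 0 < h ->
  exists B, forall t : nat,
    exists2 x, a < x < a + 2 * h & `|birkhoff_sum f t x| <= B.
Proof.
move=> cf pf f0 a0 h0.
have [H [G [M [dH dG HM]]]] := @zero_mean_second_antiderivative _ _ cf pf f0.
have M0 : 0 <= M by rewrite (le_trans _ (HM 0 _)).
have kx0 (k : nat) (x : R) : a <= x -> 0 <= k.+1%:R * x.
  by move=> ax; rewrite mulr_ge0// (le_trans a0).
exists (`|f 0| + 8 * M / h ^+ 2) => -[|t].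
  exists (a + h); first by apply/andP; split; lra.
  have h1 := ltW h0.
  by rewrite /birkhoff_sum big_ord0 normr0 addr_ge0 ?divr_ge0 ?mulr_ge0.
(* The term of index 0 of the Birkhoff sum is the constant f 0; the others are
   numbered from k.+1 = 1, and their sum is ddPhi. *)
pose Phi x : R := \sum_(k < t) k.+1%:R ^- 2 * H (k.+1%:R * x).
pose dPhi x : R := \sum_(k < t) k.+1%:R^-1 * G (k.+1%:R * x).
pose ddPhi x : R := \sum_(k < t) f (k.+1%:R * x).
have d1 (x : R) : a <= x -> is_derive x 1 Phi (dPhi x).
  move=> ax.
  rewrite (_ : Phi = \sum_(k < t) (fun x => k.+1%:R ^- 2 * H (k.+1%:R * x))).
    apply: is_derive_sum => k.
    have /is_derive_dilation dk := dH _ (kx0 k x ax).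
    have := is_deriveZ (k.+1%:R ^- 2) dk.
    rewrite [X in is_derive _ _ _ X -> _](_ : _ =
      k.+1%:R^-1 * G (k.+1%:R * x)) => [//|].
    by rewrite /GRing.scale/=; field; rewrite addrC natr1 pnatr_eq0.
  by apply/funext => y; rewrite fct_sumE.
have d2 (x : R) : a <= x -> is_derive x 1 dPhi (ddPhi x).
  move=> ax.
  rewrite (_ : dPhi = \sum_(k < t) (fun x => k.+1%:R^-1 * G (k.+1%:R * x))).
    apply: is_derive_sum => k.
    have /is_derive_dilation dk := dG _ (kx0 k x ax).
    have := is_deriveZ (k.+1%:R^-1) dk.
    rewrite [X in is_derive _ _ _ X -> _](_ : _ = f (k.+1%:R * x)) => [//|].
    by rewrite /GRing.scale/= mulrC mulfK// pnatr_eq0.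
  by apply/funext => y; rewrite fct_sumE.
have PhiM x : a <= x -> `|Phi x| <= 2 * M.
  move=> ax; apply: (le_trans (ler_norm_sum _ _ _)).
  apply: (@le_trans _ _ (\sum_(k < t) k.+1%:R ^- 2 * M)).
    apply: ler_sum => k _; rewrite normrM ger0_norm ?invr_ge0 ?exprn_ge0//.
    by rewrite ler_wpM2l ?invr_ge0 ?exprn_ge0// HM// kx0.
  by rewrite -mulr_suml ler_wpM2r// sum_inv_sqr_le2.
have [x /andP[ax xh] E] := @second_difference_mean_value _ _ _ _ _ _ h0 d1 d2.
exists x; first by rewrite ax.
rewrite /birkhoff_sum big_ord_recl/= mul0r.
apply: (le_trans (ler_normD _ _)); rewrite lerD2l.
rewrite -[X in `|X|]/(ddPhi x) ler_pdivlMr ?exprn_gt0//.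
rewrite -[X in _ * X]ger0_norm ?sqr_ge0// -normrM -E.
have Pa := PhiM _ (lexx a).
have Ph : `|Phi (a + h)| <= 2 * M by apply: PhiM; lra.
have P2h : `|Phi (a + 2 * h)| <= 2 * M by apply: PhiM; lra.
move: Pa Ph P2h; rewrite !ler_norml => /andP[? ?] /andP[? ?] /andP[? ?].
by apply/andP; split; lra.
Qed.

(** * Lower limit and Baire category *)

Lemma limn_einf_eq0 (R : realType) (u : nat -> R) :
  (\forall t \near \oo, 0 <= u t) ->
  (forall (e : R) (N : nat), 0 < e -> exists2 t, (N <= t)%N & u t <= e) ->
  limn_einf (fun t => (u t)%:E) = 0%E.
Proof.
move=> [N _ u0] uP; rewrite limn_einf_lim; apply/eqP; rewrite eq_le.
apply/andP; split.
  apply: lime_le; first exact: is_cvg_einfs.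
  apply: nearW => n; apply/lee_addgt0Pr => e e0; rewrite add0e.
  have [t nt ut] := uP e n e0.
  apply: (@le_trans _ _ (u t)%:E); last by rewrite lee_fin.
  by apply: ereal_inf_lbound; exists t.
apply: lime_ge; first exact: is_cvg_einfs.
exists N => // n /= Nn; apply: le_ereal_inf_tmp => _ [t /= nt <-].
by rewrite lee_fin u0//= (leq_trans Nn).
Qed.

Theorem theorem3 (R : realType) (psi : nat -> R)
  (psi_pinfty : psi t @[t --> \oo] --> +oo)
  (f : R -> R) (f_continuous : continuous f) (f_periodic : periodic f 1)
  (f_mean0 : \int[lebesgue_measure]_(x in `[0, 1]) f x = 0) :
  exists alpha : R, irrational alpha /\
    limn_einf (fun t : nat => (`|birkhoff_sum f t alpha| / psi t)%:E) = 0%E.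
Proof.
have psi_gt (A : R) : exists N, forall t, (N <= t)%N -> A < psi t.
  by have /cvgryPgt/(_ A)[N _ NP] := psi_pinfty; exists N => t /NP.
(* The sums are controlled at positive angles only; adding the negative
   half-line makes U n dense in R, and a point of the intersection is then sought
   among the positive angles. *)
pose U (n : nat) : set R := [set x | x < 0] `|`
  \bigcup_(t in [set t | (n <= t)%N /\ 0 < psi t])
    [set x | `|birkhoff_sum f t x| < psi t / n.+1%:R].
have oU n : open (U n).
  apply: openU; first exact: open_lt.
  apply: bigcup_open => t _.
  apply: (@open_comp _ _ (fun x => `|birkhoff_sum f t x|) [set y | y < _]).
    move=> x _; apply: continuous_comp; last exact: norm_continuous.
    exact: birkhoff_sum_continuous.
  exact: open_lt.
have dU n : dense (U n).
  move=> O [x Ox] oO.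
  have [x0|x0] := ltP x 0; first by exists x; split => //; left.
  have /nbhs_ballP[e /= e0 eO] : nbhs x O by exact: open_nbhs_nbhs.
  have e20 : 0 < e / 2 by rewrite divr_gt0.
  have [B BP] :=
    @birkhoff_sum_bounded_somewhere _ _ _ _ f_continuous f_periodic f_mean0 x0 e20.
  have [N NP] := psi_gt (Num.max 0 (B * n.+1%:R)).
  have [y /andP[xy ye] By] := BP (maxn n N).
  have := NP _ (leq_maxr n N); rewrite gt_max => /andP[psi0 psiB].
  exists y; split.
    by apply: eO; rewrite /ball/= ltr_norml; apply/andP; split; lra.
  right; exists (maxn n N) => /=; first by rewrite leq_maxl.
  by rewrite (le_lt_trans By)// ltr_pdivlMr.
have [A oA irrA] := @irrational_Gdelta R.
have /Baire dUA n : open (U n `&` A n) /\ dense (U n `&` A n).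
  by have [oAn dAn] := oA n; split; [exact: openI|exact: denseI].
have [|alpha [/= alpha0 UA]] := dUA [set x | 0 < x] _ (@open_gt _ 0).
  by exists 1 => /=.
exists alpha; split; first by rewrite irrA => n _; have [] := UA n I.
have [N0 N0P] := psi_gt 0.
apply: limn_einf_eq0.
  by exists N0 => // t /= /N0P psi0; rewrite divr_ge0// ltW.
move=> e N e0.
(* This n ensures both t >= N and 1 / (n + 1) <= e. *)
pose n := maxn N (Num.truncn e^-1).
have [[/= alphaN|[t [nt psi0] /= St]] _] := UA n I.
  by have := lt_trans alphaN alpha0; rewrite ltxx.
exists t; first by rewrite (leq_trans _ nt)// leq_maxl.
rewrite ler_pdivrMr// (le_trans (ltW St))// mulrC ler_wpM2r ?(ltW psi0)//.
rewrite -[e]invrK lef_pV2 ?posrE ?invr_gt0//.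
apply: (le_trans (ltW (truncnS_gt _))).
by rewrite ler_nat ltnS leq_maxr.
Qed.
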